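(* Let $\lambda$ be an odd positive integer and $k$ a positive integer with $k\not\equiv 1\pmod 4$. Then no $k$-MOFS$(2\lambda)$ satisfies a full relation.
   Context: Let $N(n)=\{1,\dots,n\}$ and let $n$ be even. A (binary) frequency square of order $n$ is an $n\times n$ array indexed by $N(n)\times N(n)$ with entries in $\{0,1\}$ such that every row and every column contains exactly $n/2$ zeros and $n/2$ ones. Two frequency squares $F,G$ of order $n$ are orthogonal if for each $(a,b)\in\{0,1\}^2$ the number of cells $(r,c)$ with $(F[r,c],G[r,c])=(a,b)$ equals $n^2/4$. A $k$-MOFS$(n)$ is an ordered set $F_1,\dots,F_k$ of pairwise orthogonal frequency squares of order $n$. Relations: form the $n^2\times(k+2)$ array $\mathcal O$ having a row $(i,j,F_1[i,j],\dots,F_k[i,j])$ for each $(i,j)\in N(n)^2$. Let $Y_1=Y_2=N(n)$ and $Y_c=\{0,1\}$ for $3\le c\le k+2$. A relation is a tuple $(X_1,\dots,X_{k+2})$ with $X_c\subseteq Y_c$ for all $c$ such that every row of $\mathcal O$ has an even number of positions $c$ for which the $c$-th entry of the row lies in $X_c$. A relation is trivial on column $c$ if $X_c=\emptyset$ or $X_c=Y_c$; it is full if it is non-trivial on every column $c\in\{1,\dots,k+2\}$ except possibly one of the columns $1,2$. *)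

(* Defs.v *)
From HB Require Import structures.
From mathcomp Require Import all_boot all_order all_algebra.

Set Implicit Arguments.
Unset Strict Implicit.
Unset Printing Implicit Defensive.

(* Rows and columns are indexed by 'I_n = {0, ..., n-1}; the symbols 0 and 1   *)
(* are the booleans false and true.                                           *)

Definition freq_square (n : nat) (F : 'M[bool]_n) : Prop :=
  (forall (r : 'I_n) (a : bool), #|[set c : 'I_n | F r c == a]| = n./2) /\
  (forall (c : 'I_n) (a : bool), #|[set r : 'I_n | F r c == a]| = n./2).

Definition orthogonal_squares (n : nat) (F G : 'M[bool]_n) : Prop :=
  forall a b : bool,
    #|[set rc : 'I_n * 'I_n | (F rc.1 rc.2, G rc.1 rc.2) == (a, b)]|
    = n ^ 2 %/ 4.

Definition mofs (k n : nat) (F : 'I_k -> 'M[bool]_n) : Prop :=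
  (forall c : 'I_k, freq_square (F c)) /\
  (forall c d : 'I_k, c != d -> orthogonal_squares (F c) (F d)).

(* A tuple (X_1, ..., X_{k+2}) with X_c a subset of Y_c: set_rows is X_1,      *)
(* set_cols is X_2, and set_syms c is the entry for the square F c.           *)
Record subset_tuple (k n : nat) := SubsetTuple {
  set_rows : {set 'I_n};
  set_cols : {set 'I_n};
  set_syms : 'I_k -> {set bool}
}.

(* The number of positions at which the row (i, j, F_1[i,j], ..., F_k[i,j])    *)
(* of the array has its entry in the corresponding set of X.                  *)
Definition num_hits (k n : nat) (F : 'I_k -> 'M[bool]_n)
    (X : subset_tuple k n) (i j : 'I_n) : nat :=
  (i \in set_rows X) + (j \in set_cols X)
    + \sum_(c < k) (F c i j \in set_syms X c).

Definition is_relation (k n : nat) (F : 'I_k -> 'M[bool]_n)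
    (X : subset_tuple k n) : Prop :=
  forall i j : 'I_n, ~~ odd (num_hits F X i j).

Definition trivial_set (Y : finType) (A : {set Y}) : Prop :=
  A = set0 \/ A = setT.

Definition full (k n : nat) (X : subset_tuple k n) : Prop :=
  (forall c : 'I_k, ~ trivial_set (set_syms X c)) /\
  (~ trivial_set (set_rows X) \/ ~ trivial_set (set_cols X)).

(* Main.v *)
(** Replace each square F_c by the 0/1 indicator G_c of its entries lying in the
    symbol set X_c; fullness makes the G_c again pairwise orthogonal frequency
    squares.  Let H = sum_c G_c, and let a, b be the numbers of selected rows
    and columns.  The relation says H(i,j) = r_i + s_j mod 2.
    Summing this over one row and over one column gives a = b = k mod 2;
    summing it against a fixed G_c gives (k+1) lambda^2 = (a+b) lambda mod 2,
    so k, a and b are odd.  Then H^2 = (r_i + s_j)^2 mod 4, and summing over all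
    cells gives k(k+1) lambda^2 = 2 lambda (a+b) + 2ab = 2 mod 4,
    which forces k = 1 mod 4. *)
Require Import Defs.
From HB Require Import structures.
From mathcomp Require Import all_boot all_order all_algebra.
From mathcomp Require Import zify ring.

Set Implicit Arguments.
Unset Strict Implicit.
Unset Printing Implicit Defensive.

Lemma modn_sum_congr (I : finType) (d : nat) (f g : I -> nat) :
  (forall i, f i = g i %[mod d]) -> \sum_i f i = \sum_i g i %[mod d].
Proof.
move=> fg; rewrite -modn_summ -[in RHS]modn_summ.
by congr (_ %% _); apply: eq_bigr => i _; apply: fg.
Qed.

(** Both factors of [(x - y) * (x + y)] are even; taking [y <= x] keeps the natural-number
    difference from truncating. *)
Lemma modn4_sqr (x y : nat) : x = y %[mod 2] -> x ^ 2 = y ^ 2 %[mod 4].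
Proof.
wlog le_yx : x y / y <= x.
  by case: (leqP y x) => [|/ltnW] h W e; [|apply/esym]; apply: W.
move/eqP; rewrite eqn_mod_dvd // => dvd2; apply/eqP.
rewrite eqn_mod_dvd ?leq_exp2r // subn_sqr (@dvdn_mul 2 2) //.
by move: dvd2; lia.
Qed.

Lemma sum_eqb_card (T : finType) (f : T -> bool) (v : bool) :
  \sum_x (f x == v : nat) = #|[set x | f x == v]|.
Proof. by rewrite -sum1dep_card [RHS]big_mkcond; apply: eq_bigr => x _; case: eqP. Qed.

(** A non-trivial set of booleans is a singleton, and its only element is the truth value of
    [true \in A]. *)
Lemma nontrivial_bool_set (A : {set bool}) : ~ trivial_set A ->
  forall b, (b \in A) = (b == (true \in A)).
Proof.
move=> ntA [] /=; first by case: (true \in A).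
case At: (true \in A); case Af: (false \in A) => //; case: ntA.
- by right; apply/setP => -[]; rewrite inE.
- by left; apply/setP => -[]; rewrite inE.
Qed.

(** Idempotence encodes that the matrices [G c] have entries 0 and 1 while they stay in [nat], where
    they can be summed. *)
Lemma sum_indicators_relation (n l k : nat) (G : 'I_k -> 'I_n -> 'I_n -> nat)
    (r s : 'I_n -> bool) :
  n = 2 * l -> odd l -> 0 < k ->
  (forall c i j, G c i j * G c i j = G c i j) ->
  (forall c i, \sum_j G c i j = l) ->
  (forall c j, \sum_i G c i j = l) ->
  (forall c d : 'I_k, c != d -> \sum_i \sum_j G c i j * G d i j = l ^ 2) ->
  (forall i j, \sum_c G c i j = r i + s j %[mod 2]) ->
  k = 1 %[mod 4].
Proof.
move=> n2l odd_l k_gt0 Gidem Grow Gcol Gorth Grel.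
set a := \sum_i (r i : nat); set b := \sum_j (s j : nat).
pose H i j := \sum_c G c i j.
have l_gt0 : 0 < l by case: (l) odd_l.
have i0 : 'I_n by apply: (@Ordinal _ 0); rewrite n2l muln_gt0.
(* Along row [i0] the selected-row term contributes [n * r i0], which is even. *)
have kl_b : k * l = b %[mod 2].
  transitivity ((\sum_j H i0 j) %% 2).
    rewrite /H exchange_big /=; under eq_bigr => c _ do rewrite Grow.
    by rewrite sum_nat_const card_ord.
  rewrite (modn_sum_congr (Grel _)) big_split /= sum_nat_const card_ord -/b.
  by rewrite [in n * _]n2l -mulnA mulnC modnMDl.
have kl_a : k * l = a %[mod 2].
  transitivity ((\sum_i H i i0) %% 2).
    rewrite /H exchange_big /=; under eq_bigr => c _ do rewrite Gcol.
    by rewrite sum_nat_const card_ord.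
  rewrite (modn_sum_congr (fun i => Grel i _)) big_split /= sum_nat_const card_ord -/a.
  by rewrite addnC [in n * _]n2l -mulnA mulnC modnMDl.
have GH c : \sum_i \sum_j G c i j * H i j = k.+1 * l ^ 2.
  transitivity (\sum_d \sum_i \sum_j G c i j * G d i j).
    rewrite [RHS]exchange_big; apply: eq_bigr => i _; rewrite [RHS]exchange_big.
    by apply: eq_bigr => j _; rewrite big_distrr.
  (* The diagonal term is the number of ones of [G c], namely [n * l = 2 * l ^ 2]; with the other
     [k - 1] terms this makes the factor [k.+1]. *)
  rewrite (bigD1 c) //= [X in _ + X](eq_bigr (fun=> l ^ 2)); last first.
    by move=> d dc; apply: Gorth; rewrite eq_sym.
  under eq_bigr => i _ do under eq_bigr => j _ do rewrite Gidem.
  under eq_bigr => i _ do rewrite Grow.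
  rewrite !sum_nat_const card_ord n2l cardC1 card_ord.
  by case: (k) k_gt0 => // k' _ /=; ring.
have GHmod (c : 'I_k) : k.+1 * l ^ 2 = (a + b) * l %[mod 2].
  rewrite -(GH c) mulnDl /a /b !big_distrl /=.
  transitivity ((\sum_i \sum_j G c i j * (r i + s j)) %% 2).
    apply: modn_sum_congr => i; apply: modn_sum_congr => j.
    by rewrite -modnMmr Grel modnMmr.
  congr (_ %% _); under eq_bigr => i _ do under eq_bigr => j _ do rewrite mulnDr.
  under eq_bigr => i _ do rewrite big_split /=.
  rewrite big_split /=; congr (_ + _).
    by apply: eq_bigr => i _; rewrite -big_distrl /= Grow mulnC.
  rewrite exchange_big; apply: eq_bigr => j _.
  by rewrite -big_distrl /= Gcol mulnC.
have HH : \sum_i \sum_j H i j ^ 2 = k * (k.+1 * l ^ 2).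
  transitivity (\sum_c \sum_i \sum_j G c i j * H i j).
    rewrite [RHS]exchange_big; apply: eq_bigr => i _; rewrite [RHS]exchange_big.
    by apply: eq_bigr => j _; rewrite -big_distrl /= mulnn.
  by under eq_bigr => c _ do rewrite GH; rewrite sum_nat_const card_ord.
have HHmod : k * (k.+1 * l ^ 2) = 2 * (l * (a + b) + a * b) %[mod 4].
  rewrite -HH; transitivity ((\sum_i \sum_j (r i + s j) ^ 2) %% 4).
    apply: modn_sum_congr => i; apply: modn_sum_congr => j.
    by rewrite (modn4_sqr (Grel i j)).
  congr (_ %% _).
  (* For 0/1 values [(r + s) ^ 2 = r + s + 2 * r * s], here summed over [j]. *)
  transitivity (\sum_i (n * r i + (b + 2 * r i * b))).
    apply: eq_bigr => i _; rewrite -[in n * _](card_ord n) -sum_nat_const /b.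
    rewrite big_distrr -!big_split /=; apply: eq_bigr => j _.
    by case: (r i); case: (s j).
  rewrite !big_split /= -big_distrr /= sum_nat_const card_ord -/a.
  by rewrite -big_distrl -big_distrr /= -/a n2l; ring.
have odd2 m p : m = p %[mod 2] -> odd m = odd p.
  by rewrite !modn2 ; case: (odd m); case: (odd p).
have := odd2 _ _ kl_a; have := odd2 _ _ kl_b.
have := odd2 _ _ (GHmod (Ordinal k_gt0)).
rewrite !oddM oddD odd_l /= !andbT => ok kb ka.
(* Since [a] and [b] have the parity of [k], [a + b] is even, hence so is [k.+1]. *)
have [odd_a odd_b odd_k] : [/\ odd a, odd b & odd k].
  by move: ok; rewrite -ka -kb; case: (odd k).
have odd_c : odd (l * (a + b) + a * b).
  by rewrite oddD !oddM oddD odd_l odd_a odd_b.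
(* An odd [k] is 1 or 3 mod 4. If it is 3, the left side of [HHmod] vanishes mod 4, while the right
   side is twice an odd number. *)
case: (boolP (4 %| k.+1)) => [dvd4|]; last by move: odd_k; lia.
have : 4 %| 2 * (l * (a + b) + a * b).
  by rewrite /dvdn -HHmod -/(dvdn _ _) dvdn_mull // dvdn_mulr.
by rewrite (@dvdn_pmul2l 2 2) // dvdn2 odd_c.
Qed.

Theorem theorem2p4 (lambda k : nat) (lambda_odd : odd lambda)
    (k_pos : 0 < k) (k_mod : k <> 1 %[mod 4])
    (F : 'I_k -> 'M[bool]_(2 * lambda)) (F_mofs : mofs F) :
  ~ exists X : subset_tuple k (2 * lambda), is_relation F X /\ full X.
Proof.
case=> X [Xrel [Xsyms _]]; apply: k_mod.
case: F_mofs => Fsq Forth.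
pose v c := true \in set_syms X c.
have memX c b : (b \in set_syms X c) = (b == v c) by exact: nontrivial_bool_set.
have half : (2 * lambda)./2 = lambda by rewrite mul2n doubleK.
apply: (@sum_indicators_relation (2 * lambda) lambda k
  (fun c i j => F c i j == v c) (fun i => i \in set_rows X)
  (fun j => j \in set_cols X)) => //.
- by move=> c i j; case: (_ == _).
- by move=> c i; rewrite sum_eqb_card (Fsq c).1 half.
- by move=> c j; rewrite (sum_eqb_card (fun i => F c i j)) (Fsq c).2 half.
- move=> c d cd; rewrite pair_big /=.
  transitivity ((2 * lambda) ^ 2 %/ 4); last by rewrite expnMn mulKn.
  rewrite -(Forth _ _ cd (v c) (v d)) -sum1dep_card [RHS]big_mkcond.
  by apply: eq_bigr => -[i j] _ /=; rewrite xpair_eqE; do 2 case: (_ == _).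
(* Mod 2, an even total of hits makes the symbol hits congruent to the row and column hits. *)
- move=> i j; have := Xrel i j; rewrite /num_hits.
  have -> : \sum_c (F c i j \in set_syms X c) = \sum_c (F c i j == v c).
    by apply: eq_bigr => c _; rewrite memX.
  by lia.
Qed.
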